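(* Let $H$ be a graph that is not complete, has no induced co-claw, and has no induced butterfly. If $G$ is the complement of the line graph of $H$, then $\chi(G)=\tau(H)$.
   Context: Graphs are finite and simple. The complement of the line graph of a graph $H$ is the graph whose vertices are the edges of $H$, two of them being adjacent exactly when they are disjoint as edges of $H$. $\chi$ is the chromatic number and $\tau(H)$ is the vertex cover number of $H$ (minimum size of a set of vertices meeting every edge). A co-claw is the graph formed by an isolated vertex together with a (vertex-disjoint) triangle. A butterfly is the union of two triangles sharing exactly one vertex (five vertices, six edges). *)

(* Defs.v *)
From mathcomp Require Import all_boot.

Set Implicit Arguments.
Unset Strict Implicit.
Unset Printing Implicit Defensive.

Record sgraph := SGraph {
  vertex :> finType;
  adj : rel vertex;
  adj_sym : symmetric adj;
  adj_irrefl : irreflexive adj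
}.

Definition complete (H : sgraph) : bool :=
  [forall x : H, forall y : H, (x != y) ==> adj x y].

Definition has_induced (F H : sgraph) : Prop :=
  exists f : F -> H, injective f /\ forall x y : F, adj (f x) (f y) = adj x y.

(* Isolated vertex 0, triangle {1, 2, 3}. *)
Definition coclaw_adj : rel 'I_4 := fun x y => [&& x != y, 0 < x & 0 < y].

Lemma coclaw_adj_sym : symmetric coclaw_adj.
Proof. by move=> x y; rewrite /coclaw_adj eq_sym [(0 < x) && _]andbC. Qed.

Lemma coclaw_adj_irrefl : irreflexive coclaw_adj.
Proof. by move=> x; rewrite /coclaw_adj eqxx. Qed.

Definition coclaw : sgraph := SGraph coclaw_adj_sym coclaw_adj_irrefl.

(* Triangles {0, 1, 2} and {0, 3, 4}. *)
Definition butterfly_adj : rel 'I_5 := fun x y =>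
  (x != y) && [|| x == 0 :> nat, y == 0 :> nat | (x <= 2) == (y <= 2)].

Lemma butterfly_adj_sym : symmetric butterfly_adj.
Proof.
move=> x y; rewrite /butterfly_adj eq_sym orbCA.
by rewrite [(x <= 2) == _]eq_sym.
Qed.

Lemma butterfly_adj_irrefl : irreflexive butterfly_adj.
Proof. by move=> x; rewrite /butterfly_adj eqxx. Qed.

Definition butterfly : sgraph := SGraph butterfly_adj_sym butterfly_adj_irrefl.

Definition is_edge (H : sgraph) (e : {set H}) : bool :=
  [exists x : H, exists y : H, adj x y && (e == [set x; y])].

Definition edge (H : sgraph) : finType := {e : {set H} | is_edge e}.

Definition line_adj (H : sgraph) : rel (edge H) := fun e f =>
  (e != f) && ~~ [disjoint val e & val f].

Lemma line_adj_sym (H : sgraph) : symmetric (@line_adj H).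
Proof. by move=> e f; rewrite /line_adj eq_sym disjoint_sym. Qed.

Lemma line_adj_irrefl (H : sgraph) : irreflexive (@line_adj H).
Proof. by move=> e; rewrite /line_adj eqxx. Qed.

Definition line_graph (H : sgraph) : sgraph :=
  SGraph (@line_adj_sym H) (@line_adj_irrefl H).

Definition compl_adj (G : sgraph) : rel G := fun x y => (x != y) && ~~ adj x y.

Lemma compl_adj_sym (G : sgraph) : symmetric (@compl_adj G).
Proof. by move=> x y; rewrite /compl_adj eq_sym adj_sym. Qed.

Lemma compl_adj_irrefl (G : sgraph) : irreflexive (@compl_adj G).
Proof. by move=> x; rewrite /compl_adj eqxx. Qed.

Definition compl (G : sgraph) : sgraph :=
  SGraph (@compl_adj_sym G) (@compl_adj_irrefl G).

Lemma compl_line_adjE (H : sgraph) (e f : compl (line_graph H)) :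
  adj e f = [disjoint val e & val f].
Proof.
rewrite /= /compl_adj /= /line_adj negb_and !negbK.
have [<-|//] := eqVneq e f.
case: e => e He /=; apply/esym/negbTE.
case/existsP: (He) => x /existsP[y /andP[_ /eqP e_xy]].
by apply/pred0Pn; exists x; rewrite /= e_xy !inE eqxx.
Qed.

Definition colorable (G : sgraph) (k : nat) : bool :=
  [exists c : {ffun G -> 'I_k},
    [forall x : G, forall y : G, adj x y ==> (c x != c y)]].

Lemma colorable_ex (G : sgraph) : exists k, colorable G k.
Proof.
exists #|G|; apply/existsP; exists [ffun x => enum_rank x].
apply/forallP => x; apply/forallP => y; apply/implyP => xy.
rewrite !ffunE (inj_eq enum_rank_inj).
by apply: contraTneq xy => ->; rewrite adj_irrefl.
Qed.

Definition chi (G : sgraph) : nat := ex_minn (colorable_ex G).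

Definition vertex_cover (H : sgraph) (S : {set H}) : bool :=
  [forall x : H, forall y : H, adj x y ==> (x \in S) || (y \in S)].

(* The whole vertex set is always a cover, so the [arg min] is proper. *)
Definition tau (H : sgraph) : nat :=
  #|[arg min_(S < [set: H] | vertex_cover S) #|S|]|.

(* Main.v *)
Require Import Defs.
From mathcomp Require Import all_boot.

(** A colour class of the complement of the line graph is a family of pairwise
    meeting edges, hence a star or contained in a set of three vertices.  So
    [chi] is the least weight [#|S| + #|F|] of a mixed cover: vertices [S] and
    sets [F] of at most three vertices such that each edge meets [S] or lies in
    a member of [F].  It remains to turn a mixed cover into a vertex cover of no larger weight.

    Suppose that no nonempty subfamily [B] of [F] can be traded for at most
    [#|B|] vertices.  Trading one member for one vertex shows that [F] consists
    of edge-disjoint triangles avoiding [S], which partition the edges outside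
    [S].  Let [deg v] be the number of these triangles at [v].  If [#|F| > 1],
    then co-claw-freeness gives [deg v >= 1] outside [S], and together with
    butterfly-freeness, trading few triangles near [v] rules out [deg v = 1] and
    [deg v = 2].  But if [deg v >= 3] everywhere, then double counting yields at
    most [#|F|] vertices outside [S], and all of [F] can be traded for them.  If
    [F] is a single triangle, then by co-claw-freeness it is the complement of
    [S], and all vertices but two nonadjacent ones form a vertex cover. *)

Set Implicit Arguments.
Unset Strict Implicit.
Unset Printing Implicit Defensive.

(** * Mixed covers and trades *)

Lemma adj_neq (H : sgraph) (x y : H) : adj x y -> x != y.
Proof. by apply: contraTneq => ->; rewrite adj_irrefl. Qed.

Lemma vertex_coverT (H : sgraph) : vertex_cover [set: H].
Proof. by apply/forallP=> x; apply/forallP=> y; rewrite !inE implybT. Qed.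

Definition mixed_cover (H : sgraph) (S : {set H}) (F : {set {set H}}) : bool :=
  [forall x, forall y, adj x y ==>
    [|| x \in S, y \in S | [exists T in F, (x \in T) && (y \in T)]]].

Lemma mixed_coverP (H : sgraph) (S : {set H}) (F : {set {set H}}) :
  reflect (forall x y, adj x y -> x \notin S -> y \notin S ->
             exists2 T, T \in F & (x \in T) && (y \in T))
          (mixed_cover S F).
Proof.
apply: (iffP forallP) => [cov x y xy xS yS | cov x].
  have /forallP/(_ y)/implyP/(_ xy) := cov x.
  by rewrite (negPf xS) (negPf yS) => /exists_inP.
apply/forallP=> y; apply/implyP=> xy.
case: (boolP (x \in S)) => //= xS; case: (boolP (y \in S)) => //= yS.
by apply/exists_inP; apply: cov.
Qed.

(** Since [B] is nonempty, each trade shrinks [F], so trading terminates; [#|A| <= #|B|] keeps the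
    weight from growing. *)
Definition reducible (H : sgraph) (S : {set H}) (F : {set {set H}}) : bool :=
  [exists A : {set H}, exists B : {set {set H}},
    [&& B \subset F, B != set0, #|A| <= #|B| & mixed_cover (S :|: A) (F :\: B)]].

(** * Irreducible mixed covers: edge-disjoint triangles off [S] *)

Section Irreducible.

Variables (H : sgraph) (S : {set H}) (F : {set {set H}}).
Hypothesis coverSF : mixed_cover S F.
Hypothesis cardF : {in F, forall T : {set H}, #|T| <= 3}.
Hypothesis irr : ~~ reducible S F.

Lemma not_mixed_cover (A : {set H}) (B : {set {set H}}) :
  B \subset F -> B != set0 -> #|A| <= #|B| -> ~~ mixed_cover (S :|: A) (F :\: B).
Proof.
move=> BF B0 AB; apply: contra irr => cov.
by apply/existsP; exists A; apply/existsP; exists B; apply/and4P.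
Qed.

Lemma adj_triangle x y : adj x y -> x \notin S -> y \notin S ->
  exists T, [/\ T \in F, x \in T & y \in T].
Proof.
by move=> xy xS yS; case/mixed_coverP/(_ x y xy xS yS): coverSF => T TF /andP[]; exists T.
Qed.

(** [T] cannot be traded for [v]; an edge left uncovered by that trade is covered by [T] alone. *)
Lemma private_edge T v : T \in F -> exists x y,
  [/\ adj x y, x != v & y != v] /\
  [/\ x \notin S, y \notin S, x \in T, y \in T &
      forall T', T' \in F -> x \in T' -> y \in T' -> T' = T].
Proof.
move=> TF.
have : ~~ mixed_cover (S :|: [set v]) (F :\: [set T]).
  by apply: not_mixed_cover; rewrite ?sub1set ?cards1 // -card_gt0 cards1.
rewrite negb_forall => /existsP[x]; rewrite negb_forall => /existsP[y].
rewrite negb_imply !negb_or !inE !negb_or negb_exists_in.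
case/and4P=> xy /andP[xS xv] /andP[yS yv] /forall_inP uniqT.
have eqT T' : T' \in F -> x \in T' -> y \in T' -> T' = T.
  move=> T'F xT' yT'; apply/eqP/negPn/negP=> T'T.
  by have := uniqT T'; rewrite !inE T'T T'F xT' yT' => /(_ isT).
have [T' [T'F xT' yT']] := adj_triangle xy xS yS.
have eT := eqT T' T'F xT' yT'; rewrite eT in xT' yT'.
by exists x, y.
Qed.

(** For [v] in [T], a private edge avoiding [v] supplies two further vertices of [T]. *)
Lemma card_triangle T : T \in F -> #|T| = 3.
Proof.
move=> TF; apply/eqP; rewrite eqn_leq cardF //=.
have [T0|[v vT]] := set_0Vmem T.
  (* [private_edge] asks for a vertex. For empty [T], the failed trade of [T] for no vertex at all
     provides one. *)
  have [v _] : exists v : H, true.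
    have : ~~ mixed_cover (S :|: set0) (F :\: [set T]).
      by apply: not_mixed_cover; rewrite ?sub1set ?cards0 // -card_gt0 cards1.
    by rewrite negb_forall => /existsP[x _]; exists x.
  by have [x [y [_ []]]] := private_edge v TF; rewrite T0 inE.
have [x [y [[xy xv yv] [_ _ xT yT _]]]] := private_edge v TF.
have sub : [set v; x; y] \subset T by rewrite !subUset !sub1set vT xT yT.
apply: leq_trans (subset_leq_card sub).
by rewrite -setUA !cardsU1 cards1 !inE negb_or (adj_neq xy) ![v == _]eq_sym xv yv.
Qed.

Lemma third T x y : T \in F -> x \in T -> y \in T -> x != y ->
  exists z, [/\ z != x, z != y & T = [set x; y; z]].
Proof.
move=> TF xT yT xy; have := card_triangle TF.
rewrite (cardsD1 x) (cardsD1 y) xT !inE yT eq_sym xy !add1n => -[]/eqP/cards1P[z ez].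
have : z \in (T :\ x) :\ y by rewrite ez set11.
rewrite !inE => /and3P[zy zx zT]; exists z; split=> //.
apply/setP=> w; move/setP/(_ w): ez; rewrite !inE.
have [->|_] := eqVneq w x; first by rewrite xT.
by have [->|_ /= ->] := eqVneq w y; first by rewrite yT.
Qed.

(** The private edge of [T] that avoids its third vertex can only be [x y]. *)
Lemma triangle_edge T x y : T \in F -> x \in T -> y \in T -> x != y ->
  [/\ adj x y, x \notin S & forall T', T' \in F -> x \in T' -> y \in T' -> T' = T].
Proof.
move=> TF xT yT xy; have [z [zx zy eT]] := third TF xT yT xy.
have [a [b [[ab az bz] [aS bS aT bT uT]]]] := private_edge z TF.
have {ab}[ab nab] := (ab, adj_neq ab).
move: aT bT; rewrite {1 2}eT !inE (negPf az) (negPf bz) !orbF.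
case/orP=> /eqP ea /orP[] /eqP eb; subst a b; rewrite ?eqxx // in nab *.
by split=> //; rewrite 1?adj_sym // => T' ? ? ?; apply: uT.
Qed.

Lemma triangle_eq T T' x y : T \in F -> T' \in F -> x != y ->
  x \in T -> y \in T -> x \in T' -> y \in T' -> T = T'.
Proof.
by move=> TF T'F xy xT yT xT' yT'; have [_ _ /(_ T TF)->] := triangle_edge T'F xT' yT' xy.
Qed.

Lemma triangle_at T x : T \in F -> x \in T -> exists y z,
  [/\ y != x, z != x, z != y & T = [set x; y; z]].
Proof.
move=> TF xT; have := card_triangle TF; rewrite (cardsD1 x) xT add1n => -[e2].
have /card_gt0P[y] : 0 < #|T :\ x| by rewrite e2.
rewrite !inE => /andP[yx yT]; have [|z [zx zy eT]] := third TF xT yT; first by rewrite eq_sym.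
by exists y, z.
Qed.

Lemma triangle_notin T x : T \in F -> x \in T -> x \notin S.
Proof.
move=> TF xT; have [y [z [yx zx zy eT]]] := triangle_at TF xT.
by have [] := @triangle_edge T x y TF xT _ _; rewrite ?eT ?inE ?eqxx ?orbT // eq_sym.
Qed.

(* Triangles with two vertices in [s] have all their edges covered by [s]. *)
Lemma exchange (s : seq H) (L : seq {set H}) : uniq L -> {subset L <= F} ->
  0 < size L -> size s <= size L ->
  (forall T, T \in L -> exists x y, [/\ x != y, x \in T, y \in T, x \in s & y \in s]) ->
  False.
Proof.
move=> uL LF L0 sL two.
have cL : #|[set T in L]| = size L by rewrite cardsE; apply/card_uniqP.
have : ~~ mixed_cover (S :|: [set x in s]) (F :\: [set T in L]).
  apply: not_mixed_cover; rewrite -?card_gt0 ?cL //.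
    by apply/subsetP=> T; rewrite inE => /LF.
  by rewrite (leq_trans _ sL) // cardsE card_size.
case/negP; apply/mixed_coverP=> x y xy; rewrite !inE !negb_or => /andP[xS xs] /andP[yS ys].
have [T [TF xT yT]] := adj_triangle xy xS yS; exists T; rewrite ?xT ?yT // !inE TF andbT.
apply/negP=> /two[a [b [ab aT bT sa sb]]].
(* [a] and [b] lie in [s] while [x] and [y] do not, so both would be the third vertex of [T]. *)
have ea : [&& a != x, a != y, b != x & b != y].
  by apply/and4P; split; [apply: contraNneq xs | apply: contraNneq ys
    | apply: contraNneq xs | apply: contraNneq ys] => <-.
case/and4P: ea => ax ay bx bY.
have [z [zx zy eT]] := third TF xT yT (adj_neq xy).
move: aT bT; rewrite eT !inE (negPf ax) (negPf ay) (negPf bx) (negPf bY) /= => /eqP ea /eqP eb.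
by rewrite ea eb eqxx in ab.
Qed.

(** * Consequences of excluding co-claws and butterflies *)

Hypothesis noclaw : ~ has_induced coclaw H.
Hypothesis nofly : ~ has_induced butterfly H.

(** Without a neighbour in [T], [v] would form an induced co-claw with it. An edge from [v] to [T]
    avoids [S], hence lies in a member of [F]. *)
Lemma triangle_dominates T v : T \in F -> v \notin S -> v \notin T ->
  exists p T', [/\ p \in T, T' \in F, v \in T' & p \in T'].
Proof.
move=> TF vS vT.
have [/exists_inP[p pT vp]|] := boolP [exists p in T, adj v p].
  have [T' [T'F vT' pT']] := adj_triangle vp vS (triangle_notin TF pT).
  by exists p, T'.
rewrite negb_exists_in => /forall_inP nv; case: noclaw.
have [T0|[x xT]] := set_0Vmem T; first by have := card_triangle TF; rewrite T0 cards0.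
have [y [z [yx zx zy eT]]] := triangle_at TF xT.
have yT : y \in T by rewrite eT !inE eqxx orbT.
have zT : z \in T by rewrite eT !inE eqxx orbT.
have neq w : w \in T -> v != w by move=> wT; apply: contraNneq vT => ->.
pose t := [tuple v; x; y; z]; exists (tnth t).
have ut : uniq t.
  by rewrite /= !inE !negb_or !neq //= (eq_sym x y) (eq_sym x z) (eq_sym y z) yx zx zy.
split; first exact/tuple_uniqP.
have adjT a b : a \in T -> b \in T -> a != b -> adj a b.
  by move=> aT bT ab; have [] := triangle_edge TF aT bT ab.
have nv' w : w \in T -> adj w v = false.
  by move=> wT; rewrite adj_sym; apply/negbTE/nv.
have nv'' w : w \in T -> adj v w = false by move=> wT; apply/negbTE/nv.
case=> [[|[|[|[|//]]]] ?]; case=> [[|[|[|[|//]]]] ?];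
  rewrite !(tnth_nth v) /= /coclaw_adj -val_eqE /= ?adj_irrefl ?nv' ?nv'' //;
  by apply: adjT; rewrite // eq_sym.
Qed.

(** Two triangles sharing only [x] with no edge between their other vertices would induce a
    butterfly. Any such edge avoids [S], so a member of [F] contains it. *)
Lemma triangle_cross T T' x : T \in F -> T' \in F -> T != T' -> x \in T -> x \in T' ->
  exists p q T'', [/\ p \in T :\ x, q \in T' :\ x, T'' \in F, p \in T'' & q \in T''].
Proof.
move=> TF T'F TT' xT xT'.
have [/exists_inP[p pT /exists_inP[q qT' pq]]|] :=
    boolP [exists p in T :\ x, exists q in T' :\ x, adj p q].
  have [/setD1P[_ pT0] /setD1P[_ qT0]] := (pT, qT').
  have [T'' [? ? ?]] := adj_triangle pq (triangle_notin TF pT0) (triangle_notin T'F qT0).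
  by exists p, q, T''.
rewrite negb_exists_in => /forall_inP nadj; case: nofly.
have {}nadj p q : p \in T :\ x -> q \in T' :\ x -> adj p q = false.
  by move=> pT qT'; have := nadj p pT; rewrite negb_exists_in => /forall_inP/(_ q qT')/negbTE.
have neq p q : p \in T :\ x -> q \in T' :\ x -> p != q.
  move=> /setD1P[px pT] /setD1P[qx qT']; apply: contraNneq TT' => epq; subst q.
  by apply/eqP; apply: (triangle_eq TF T'F px).
have [a [b [ax bx ba eT]]] := triangle_at TF xT.
have [c [d [cx dx dc eT']]] := triangle_at T'F xT'.
have [aT bT] : a \in T :\ x /\ b \in T :\ x by rewrite !inE ax bx eT !inE !eqxx !orbT.
have [cT dT] : c \in T' :\ x /\ d \in T' :\ x by rewrite !inE cx dx eT' !inE !eqxx !orbT.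
pose t := [tuple x; a; b; c; d]; exists (tnth t).
have ut : uniq t.
  by rewrite /= !inE !negb_or ![x == _]eq_sym (eq_sym a b) (eq_sym c d) ax bx cx dx ba dc !neq.
split; first exact/tuple_uniqP.
have adjT p q : p \in T -> q \in T -> p != q -> adj p q.
  by move=> pT qT pq; have [] := triangle_edge TF pT qT pq.
have adjT' p q : p \in T' -> q \in T' -> p != q -> adj p q.
  by move=> pT qT pq; have [] := triangle_edge T'F pT qT pq.
have nadj' p q : p \in T :\ x -> q \in T' :\ x -> adj q p = false.
  by move=> *; rewrite adj_sym nadj.
have [aT0 bT0] : a \in T /\ b \in T by rewrite eT !inE !eqxx !orbT.
have [cT0 dT0] : c \in T' /\ d \in T' by rewrite eT' !inE !eqxx !orbT.
case=> [[|[|[|[|[|//]]]]] ?]; case=> [[|[|[|[|[|//]]]]] ?];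
  rewrite !(tnth_nth x) /= /butterfly_adj -val_eqE /= ?adj_irrefl //;
  first [by apply: nadj | by apply: nadj' | by apply: adjT => //; rewrite eq_sym
        | by apply: adjT' => //; rewrite eq_sym].
Qed.

(** * At least three triangles at each vertex outside [S] *)

Definition deg x := #|[set T in F | x \in T]|.

Lemma deg_ge1 x : F != set0 -> x \notin S -> 0 < deg x.
Proof.
case/set0Pn=> T TF xS; apply/card_gt0P.
have [xT|xT] := boolP (x \in T); first by exists T; rewrite inE TF.
by have [p [T' [_ T'F xT' _]]] := triangle_dominates TF xS xT; exists T'; rewrite inE T'F.
Qed.

(** If [T1] is the only triangle at [x], domination makes any other triangle [T] meet [T1] in some
    [p]. A triangle [T''] joins [T1] and [T] away from [p], through [p'] and [q], and the three
    triangles can be traded for [p], [p'], [q]. *)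
Lemma deg_gt1 x : 1 < #|F| -> x \notin S -> 1 < deg x.
Proof.
move=> F2 xS; have F0 : F != set0 by rewrite -card_gt0 ltnW.
rewrite ltn_neqAle deg_ge1 // andbT eq_sym; apply/negP=> /cards1P[T1 e1].
have mem1 T : T \in F -> x \in T -> T = T1.
  by move=> TF xT; apply/set1P; rewrite -e1 inE TF.
have : T1 \in [set T in F | x \in T] by rewrite e1 set11.
rewrite inE => /andP[T1F xT1].
have [T] : exists T, T \in F :\ T1.
  by apply/card_gt0P; rewrite (cardsD1 T1) T1F in F2.
case/setD1P=> TT1 TF.
have xT : x \notin T by apply: contra_neqN TT1 => /(mem1 T TF).
have [p [T' [pT T'F xT' pT']]] := triangle_dominates TF xS xT.
have pT1 : p \in T1 by rewrite -(mem1 T').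
have [p' [q [T'' [/setD1P[p'p p'T1] /setD1P[qp qT] T''F p'T'' qT'']]]] :
    exists p' q T'', [/\ p' \in T1 :\ p, q \in T :\ p, T'' \in F, p' \in T'' & q \in T''].
  by apply: triangle_cross => //; rewrite eq_sym.
have qT1 : q \notin T1.
  by apply: contra_neqN TT1 => qT1; apply: (triangle_eq TF T1F qp).
have T''T1 : T'' != T1 by apply: contraNneq qT1 => <-.
have p'T : p' \notin T.
  by apply: contra_neqN TT1 => p'T; apply: (triangle_eq TF T1F p'p).
have T''T : T'' != T by apply: contraNneq p'T => <-.
apply: (@exchange [:: p; p'; q] [:: T1; T; T'']) => //.
- by rewrite /= !inE !negb_or ![T1 == _]eq_sym (eq_sym T T'') TT1 T''T1 T''T.
- by move=> U; rewrite !inE => /or3P[] /eqP->.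
- move=> U; rewrite !inE => /or3P[] /eqP->.
  + by exists p', p; rewrite !inE !eqxx ?orbT.
  + by exists q, p; rewrite !inE !eqxx ?orbT.
  + exists p', q; rewrite !inE !eqxx ?orbT; split=> //.
    by apply: contraNneq qT1 => <-.
Qed.

Lemma crossing_neq v (T1 T2 T : {set H}) p q : T1 \in F -> T2 \in F -> T1 != T2 ->
  v \in T1 -> v \in T2 -> p \in T1 :\ v -> q \in T2 :\ v -> p \in T -> q \in T ->
  [/\ p \notin T2, q \notin T1, T != T1, T != T2 & p != q].
Proof.
move=> T1F T2F T12 vT1 vT2 /setD1P[pv pT1] /setD1P[qv qT2] pT qT.
have pT2 : p \notin T2 by apply: contra_neqN T12 => pT2; apply: (triangle_eq T1F T2F pv).
have qT1 : q \notin T1 by apply: contra_neqN T12 => qT1; apply: (triangle_eq T1F T2F qv).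
by split=> //; [apply: contraNneq qT1 | apply: contraNneq pT2 | apply: contraNneq qT1] => <-.
Qed.

(** Two distinct crossings could be traded, together with [T1] and [T2], for the four vertices other
    than [v] of [T1] and [T2]. *)
Lemma crossing_unique v (T1 T2 T3 T4 : {set H}) p q p' q' :
  T1 \in F -> T2 \in F -> T3 \in F -> T4 \in F -> T1 != T2 -> v \in T1 -> v \in T2 ->
  p \in T1 :\ v -> q \in T2 :\ v -> p \in T3 -> q \in T3 ->
  p' \in T1 :\ v -> q' \in T2 :\ v -> p' \in T4 -> q' \in T4 -> T3 = T4.
Proof.
move=> T1F T2F T3F T4F T12 vT1 vT2 pT1 qT2 pT3 qT3 p'T1 q'T2 p'T4 q'T4.
have [_ _ T31 T32 pq] := crossing_neq T1F T2F T12 vT1 vT2 pT1 qT2 pT3 qT3.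
have [_ _ T41 T42 p'q'] := crossing_neq T1F T2F T12 vT1 vT2 p'T1 q'T2 p'T4 q'T4.
apply/eqP/negPn/negP=> T34.
have [a [b [av bv ba e1]]] := triangle_at T1F vT1.
have [c [d [cv dv dc e2]]] := triangle_at T2F vT2.
have in1 w : w \in T1 :\ v -> w \in [:: a; b; c; d].
  by rewrite e1 !inE => /andP[/negPf->] /= /orP[]->; rewrite ?orbT.
have in2 w : w \in T2 :\ v -> w \in [:: a; b; c; d].
  by rewrite e2 !inE => /andP[/negPf->] /= /orP[]->; rewrite ?orbT.
apply: (@exchange [:: a; b; c; d] [:: T1; T2; T3; T4]) => //.
- by rewrite /= !inE !negb_or T12 T34 ![T1 == _]eq_sym ![T2 == _]eq_sym T31 T41 T32 T42.
- by move=> U; rewrite !inE => /or4P[] /eqP->.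
- move=> U; rewrite 4![in X in X -> _]inE => /or4P[] /eqP->.
  + by exists b, a; rewrite e1 !inE !eqxx !orbT.
  + by exists d, c; rewrite e2 !inE !eqxx !orbT.
  + by exists p, q; split=> //; [apply: in1 | apply: in2].
  + by exists p', q'; split=> //; [apply: in1 | apply: in2].
Qed.

(* Crossing triangles join two triangles [T1], [T2] at [v] away from [v].  With
   [deg v = 2] and the crossing [T3] through [a] and [c], a further triangle at
   [b] must meet [T3] in its third vertex. *)
Lemma crossing_extend v a b c d (T1 T2 T3 : {set H}) :
  T1 \in F -> T2 \in F -> T3 \in F -> T1 != T2 ->
  (forall T, T \in F -> v \in T -> T = T1 \/ T = T2) ->
  T1 = [set v; a; b] -> T2 = [set v; c; d] ->
  a != v -> b != v -> b != a -> c != v -> d != v -> d != c ->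
  a \in T3 -> c \in T3 -> 1 < deg b ->
  exists T4 f, [/\ T4 \in F, T4 != T1, T4 != T2 & T4 != T3] /\
               [/\ b \in T4, f \in T4, f \in T3, f != a & f != c].
Proof.
move=> T1F T2F T3F T12 degv e1 e2 av bv ba cv dv dc aT3 cT3 degb.
have [vT1 aT1 bT1] : [/\ v \in T1, a \in T1 & b \in T1].
  by rewrite e1 !inE !eqxx !orbT.
have [vT2 cT2 dT2] : [/\ v \in T2, c \in T2 & d \in T2].
  by rewrite e2 !inE !eqxx !orbT.
have [aT1v bT1v] : a \in T1 :\ v /\ b \in T1 :\ v by rewrite !inE av bv.
have cT2v : c \in T2 :\ v by rewrite !inE cv.
have [aT2 cT1 T31 T32 ac] := crossing_neq T1F T2F T12 vT1 vT2 aT1v cT2v aT3 cT3.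
have bT2 : b \notin T2 by apply: contra_neqN T12 => bT2; apply: (triangle_eq T1F T2F bv).
have bT3 : b \notin T3 by apply: contra_neqN T31 => bT3; apply: (triangle_eq T3F T1F ba).
have [T4] : exists T4, T4 \in [set T in F | b \in T] :\ T1.
  by apply/card_gt0P; move: degb; rewrite /deg (cardsD1 T1) inE T1F bT1.
rewrite !inE => /and3P[T41 T4F bT4].
have T42 : T4 != T2 by apply: contraNneq bT2 => <-.
have T43 : T4 != T3 by apply: contraNneq bT3 => <-.
have nT1 w : w \in T4 -> w != b -> w \notin T1.
  by move=> wT4 wb; apply: contra_neqN T41 => wT1; apply: (triangle_eq T4F T1F wb).
(* Otherwise [T4] would be a second crossing of [T1] and [T2], through [b] and [w]. *)
have nT2 w : w \in T4 -> w \notin T2 :\ v.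
  move=> wT4; apply: contra_neqN T43 => wT2; apply/esym.
  exact: (crossing_unique T1F T2F T3F T4F T12 vT1 vT2 aT1v cT2v aT3 cT3 bT1v wT2).
have T14 : T1 != T4 by rewrite eq_sym.
have [p [f [T5 [/setD1P[pb pT1] /setD1P[fb fT4] T5F pT5 fT5]]]] :=
  triangle_cross T1F T4F T14 bT1 bT4.
have fT1 := nT1 f fT4 fb.
have fv : f != v by apply: contraNneq fT1 => ->.
(* If [p] were [v], then [T5] would be [T1] or [T2], but [f] lies in neither. *)
have pa : p = a.
  move: pT1; rewrite e1 !inE (negPf pb) orbF => /orP[/eqP pv|/eqP//]; rewrite pv in pT5.
  case: (degv T5 T5F pT5) => eT5; rewrite eT5 in fT5; first by rewrite fT5 in fT1.
  by have := nT2 f fT4; rewrite !inE fv fT5.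
rewrite {p pb pT1}pa in pT5.
have fa : f != a by apply: contraNneq fT1 => ->.
have fc : f != c by apply: contraTneq (nT2 f fT4) => ->; rewrite cT2v.
exists T4, f; split=> //; split=> //.
(* If [f] were outside [T3], the five triangles would be distinct and could be traded for [a], [b],
   [c], [d], [f]. *)
apply: contraT => fT3; exfalso.
have aT4 : a \notin T4 by apply: contraL aT1 => aT4; apply: nT1; rewrite // eq_sym.
have T53 : T5 != T3 by apply: contraNneq fT3 => <-.
have T51 : T5 != T1 by apply: contraNneq fT1 => <-.
have T52 : T5 != T2 by apply: contraNneq aT2 => <-.
have T54 : T5 != T4 by apply: contraNneq aT4 => <-.
apply: (@exchange [:: a; b; c; d; f] [:: T5; T4; T3; T2; T1]) => //.
- by rewrite /= !inE !negb_or T54 T53 T52 T51 T43 T42 T41 T32 T31 eq_sym T12.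
- by move=> U; rewrite !inE => /orP[/eqP->|/or4P[] /eqP->].
- move=> U; rewrite 5![in X in X -> _]inE => /orP[|/or4P[]] /eqP->.
  + by exists f, a; rewrite !inE !eqxx !orbT.
  + by exists f, b; rewrite !inE !eqxx !orbT.
  + by exists a, c; rewrite !inE !eqxx !orbT.
  + by exists d, c; rewrite !inE !eqxx !orbT.
  + by exists b, a; rewrite !inE !eqxx !orbT.
Qed.

(** Suppose that only [T1] and [T2] contain [v], with crossing [T3] on [a], [c], [e]. Extending at
    [b] and, with the roles of [T1] and [T2] swapped, at [d] gives [T4] through [b] and [e] and [T5]
    through [d] and [e]. The five triangles can be traded for [a], [b], [c], [d], [e]. *)
Lemma deg_gt2 v : 1 < #|F| -> v \notin S -> 2 < deg v.
Proof.
move=> F2 vS; rewrite ltn_neqAle deg_gt1 // andbT eq_sym.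
apply/negP=> /cards2P[T1 [T2 [T12 e12]]].
have : T1 \in [set T in F | v \in T] by rewrite e12 !inE eqxx.
have : T2 \in [set T in F | v \in T] by rewrite e12 !inE eqxx orbT.
rewrite !inE => /andP[T2F vT2] /andP[T1F vT1].
have degv T : T \in F -> v \in T -> T = T1 \/ T = T2.
  by move=> TF vT; apply/set2P; rewrite -e12 inE TF.
have [a [c [T3 [aT1v cT2v T3F aT3 cT3]]]] := triangle_cross T1F T2F T12 vT1 vT2.
have [[av aT1] [cv cT2]] := (setD1P aT1v, setD1P cT2v).
have [aT2 cT1 T31 T32 ac] := crossing_neq T1F T2F T12 vT1 vT2 aT1v cT2v aT3 cT3.
have [|b [bv ba e1]] := third T1F vT1 aT1; first by rewrite eq_sym.
have [|d [dv dc e2]] := third T2F vT2 cT2; first by rewrite eq_sym.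
have [e [ea ec e3]] := third T3F aT3 cT3 ac.
have bT1 : b \in T1 by rewrite e1 !inE eqxx !orbT.
have dT2 : d \in T2 by rewrite e2 !inE eqxx !orbT.
have eT3 : e \in T3 by rewrite e3 !inE eqxx !orbT.
have [T4 [f [[T4F T41 T42 T43] [bT4 fT4 fT3 fa fc]]]] :=
  crossing_extend T1F T2F T3F T12 degv e1 e2 av bv ba cv dv dc aT3 cT3
    (deg_gt1 F2 (triangle_notin T1F bT1)).
have T21 : T2 != T1 by rewrite eq_sym.
have degv' T : T \in F -> v \in T -> T = T2 \/ T = T1.
  by move=> TF vT; apply/or_comm/degv.
have [T5 [h [[T5F T52 T51 T53] [dT5 hT5 hT3 hc ha]]]] :=
  crossing_extend T2F T1F T3F T21 degv' e2 e1 cv dv dc av bv ba cT3 aT3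
    (deg_gt1 F2 (triangle_notin T2F dT2)).
move: fT3 hT3; rewrite e3 !inE (negPf fa) (negPf fc) (negPf ha) (negPf hc) /=.
move=> /eqP fe /eqP he; rewrite fe in fT4; rewrite he in hT5.
(* A common triangle would contain [b] and [d], hence be a crossing of [T1] and [T2], that is,
   [T3]. *)
have T54 : T5 != T4.
  apply: contra_neq T53 => T54; apply/esym; rewrite -T54 in bT4.
  by apply: (crossing_unique T1F T2F T3F T5F T12 vT1 vT2 aT1v cT2v aT3 cT3 _ _ bT4 dT5);
    rewrite !inE ?bv ?dv.
have eb : e != b.
  by apply: contra_neq T31 => eb; rewrite eb in eT3; apply: (triangle_eq T3F T1F ba).
have ed : e != d.
  by apply: contra_neq T32 => ed; rewrite ed in eT3; apply: (triangle_eq T3F T2F dc).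
apply: (@exchange [:: a; b; c; d; e] [:: T5; T4; T3; T2; T1]) => //.
- by rewrite /= !inE !negb_or T54 T53 T52 T51 T43 T42 T41 T32 T31 T21.
- by move=> U; rewrite !inE => /orP[/eqP->|/or4P[] /eqP->].
- move=> U; rewrite 5![in X in X -> _]inE => /orP[|/or4P[]] /eqP->.
  + by exists e, d; rewrite !inE !eqxx !orbT.
  + by exists e, b; rewrite !inE !eqxx !orbT.
  + by exists a, c; rewrite !inE !eqxx !orbT.
  + by exists d, c; rewrite !inE !eqxx !orbT.
  + by exists b, a; rewrite !inE !eqxx !orbT.
Qed.

(** * Double counting and the single-triangle case *)

Lemma sum_deg : \sum_(v in ~: S) deg v = 3 * #|F|.
Proof.
have deg_sum v : deg v = \sum_(T in F) (v \in T).
  by rewrite /deg -sum1dep_card big_mkcondr; apply: eq_bigr => T _; case: (v \in T).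
under eq_bigr do rewrite deg_sum; rewrite exchange_big /=.
rewrite mulnC -sum_nat_const; apply: eq_bigr => T TF.
rewrite -(card_triangle TF) -sum1_card big_mkcond [RHS]big_mkcond /=.
apply: eq_bigr => v _; rewrite inE; have [vT|_] := boolP (v \in T); last by case: ifP.
by rewrite (triangle_notin TF vT).
Qed.

(** By double counting, [3 * #|~: S| <= 3 * #|F|], so the whole of [F] could be traded for
    [~: S]. *)
Lemma card_irreducible : #|F| <= 1.
Proof.
rewrite leqNgt; apply/negP=> F2.
have le : #|~: S| <= #|F|.
  rewrite -(leq_pmul2l (isT : 0 < 3)) -sum_deg mulnC -sum_nat_const.
  by apply: leq_sum => v; rewrite inE => vS; apply: deg_gt2.
have : ~~ mixed_cover (S :|: ~: S) (F :\: F).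
  by apply: not_mixed_cover; rewrite // -card_gt0 ltnW.
by case/negP; apply/mixed_coverP=> x y _; rewrite setUCr inE.
Qed.

Lemma irreducible_vertex_cover : ~~ complete H ->
  exists2 C : {set H}, vertex_cover C & #|C| <= #|S| + #|F|.
Proof.
case/forallPn=> x /forallPn[y]; rewrite negb_imply => /andP[xy nxy].
have := card_irreducible; case: (posnP #|F|) => [|F_gt0 F_le1].
  move/cards0_eq=> F0 _; exists S; last by rewrite F0 cards0 addn0.
  apply/forallP=> p; apply/forallP=> q; apply/implyP=> pq.
  apply: contraT; rewrite negb_or => /andP[pS qS].
  by have [T []] := adj_triangle pq pS qS; rewrite F0 inE.
have /cards1P[T eF] : #|F| == 1 by rewrite eqn_leq F_le1.
have TF : T \in F by rewrite eF set11.
(* A vertex outside both would, by domination, lie in a member of [F], which can only be [T]. *)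
have ST : S :|: T = setT.
  apply/setP=> v; rewrite !inE; have [//|vS /=] := boolP (v \in S); apply: contraT => vT.
  have [p [T' [_ T'F vT' _]]] := triangle_dominates TF vS vT.
  by move: T'F vT vT'; rewrite eF => /set1P-> /negP.
exists (~: [set x; y]).
  apply/forallP=> p; apply/forallP=> q; apply/implyP=> pq.
  rewrite !inE -negb_and; apply/negP=> /andP[/orP[]/eqP ep /orP[]/eqP eq]; move: pq nxy;
    by rewrite ep eq 1?adj_irrefl // adj_sym => ->.
(* The chosen cover has size [#|H| - 2], and [#|H| <= #|S| + 3]. *)
have := cardsC [set x; y]; rewrite cards2 xy -cardsT -ST => e.
have := leq_card_setU S T.
by rewrite -e (card_triangle TF) eF cards1 -(leq_add2l 2) addnCA => -[].
Qed.

End Irreducible.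

(** * From mixed covers to vertex covers *)

Lemma vertex_cover_of_mixed (H : sgraph) (S : {set H}) (F : {set {set H}}) :
  ~~ complete H -> ~ has_induced coclaw H -> ~ has_induced butterfly H ->
  mixed_cover S F -> {in F, forall T : {set H}, #|T| <= 3} ->
  exists2 C : {set H}, vertex_cover C & #|C| <= #|S| + #|F|.
Proof.
move=> ncomp noclaw nofly; have [n] := ubnP #|F|.
elim: n S F => // n IHn S F ltFn cov cardF.
have [/existsP[A /existsP[B /and4P[BF B0 AB cov']]]|irr] := boolP (reducible S F);
  last exact: irreducible_vertex_cover irr _ _ _.
have cardB : #|F :\: B| + #|B| = #|F| by rewrite addnC -{1}(setIidPr BF) cardsID.
have [|T|C covC leC] := IHn _ _ _ cov'.
- by rewrite -ltnS (leq_trans _ ltFn) // -cardB -addn1 ltnS leq_add2l card_gt0.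
- by rewrite inE => /andP[_ /cardF].
exists C => //; apply: leq_trans leC _; rewrite -cardB.
rewrite [_ + #|B|]addnC addnA leq_add2r.
by apply: leq_trans (leq_card_setU _ _) _; rewrite leq_add2l.
Qed.

(** * Colour classes and mixed covers *)

(** Take a member [x y]. If some [e] avoids [x] and some [f] avoids [y], then these are [y z] and
    [x z] for a common [z], and a pair meeting all three sides of this triangle is one of them. *)
Lemma intersecting_pairs (T : finType) (C : {set {set T}}) :
  {in C, forall e : {set T}, #|e| = 2} ->
  {in C &, forall e f : {set T}, ~~ [disjoint e & f]} ->
  C != set0 ->
  (exists v, {in C, forall e : {set T}, v \in e}) \/
  (exists2 A : {set T}, #|A| <= 3 & {in C, forall e : {set T}, e \subset A}).
Proof.
move=> pairC interC /set0Pn[e0 e0C].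
have /eqP/cards2P[x [y [xy e0E]]] := pairC e0 e0C.
have other u v e : [set u; v] \in C -> e \in C -> u \notin e ->
    exists w, e = [set v; w].
  move=> uvC eC ue; have /pred0Pn[w /= /andP[]] := interC _ _ uvC eC.
  rewrite !inE => /orP[]/eqP-> we; first by rewrite we in ue.
  have /eqP/cards2P[p [q [_ ep]]] := pairC e eC.
  by move: we; rewrite ep !inE => /orP[]/eqP->; [exists q | exists p; rewrite setUC].
rewrite {}e0E in e0C.
have [/forall_inP allx|/forall_inPn[e eC xe]] := boolP [forall e in C, x \in e].
  by left; exists x.
have [/forall_inP ally|/forall_inPn[f fC yf]] := boolP [forall e in C, y \in e].
  by left; exists y.
right; have [z eE] := other x y e e0C eC xe.
rewrite setUC in e0C; have [w fE] := other y x f e0C fC yf.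
rewrite eE in eC xe; have [w' fE'] := other y z f eC fC yf.
have zx : z != x by apply: contraNneq xe => ->; rewrite !inE eqxx orbT.
have fxz : f = [set x; z].
  by move: (set21 z w'); rewrite -fE' fE !inE (negPf zx) => /eqP->.
rewrite {}fxz {w w' fE fE'} in fC yf *.
exists [set x; y; z]; first by rewrite -setUA !cardsU1 cards1; do 2!case: (_ \notin _).
move=> g gC.
have pair p q : p \in g -> q \in g -> p != q -> g = [set p; q].
  move=> pg qg pq; apply/esym/eqP.
  by rewrite eqEcard subUset !sub1set pg qg (pairC g gC) cards2 pq.
have meet u v : [set u; v] \in C -> u \notin g -> v \in g.
  by move=> uvC ug; have [w ->] := other u v g uvC gC ug; rewrite set21.
have yz : y != z by apply: contraNneq yf => ->; rewrite set22.
suff [->|[->|->]] : g = [set x; y] \/ g = [set x; z] \/ g = [set y; z].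
- by rewrite subsetUl.
- by rewrite setUAC subsetUl.
- by rewrite -setUA subsetUr.
have [xg|xg] := boolP (x \in g).
  have [yg|yg] := boolP (y \in g); first by left; apply: pair.
  by right; left; apply: pair; rewrite ?(meet y z) // eq_sym.
right; right; apply: pair => //; apply: (meet x) => //.
by rewrite setUC.
Qed.

(** Colour each edge by one of its vertices in a minimum cover; edges of equal colour then meet. *)
Lemma chi_le_tau (H : sgraph) : chi (compl (line_graph H)) <= tau H.
Proof.
rewrite /tau; case: arg_minnP => [|C covC _]; first exact: vertex_coverT.
rewrite /chi; case: ex_minnP => k _; apply.
have hit (e : edge H) : exists v, (v \in C) && (v \in val e).
  case: e => e /= /existsP[x /existsP[y /andP[xy /eqP->]]].
  have /forallP/(_ y)/implyP/(_ xy)/orP[xC|yC] := forallP covC x.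
    by exists x; rewrite xC set21.
  by exists y; rewrite yC set22.
pose w e := xchoose (hit e).
have wC e : w e \in C by have /andP[] := xchooseP (hit e).
apply/existsP; exists [ffun e => enum_rank_in (wC e) (w e)].
apply/forallP=> e; apply/forallP=> f; rewrite compl_line_adjE; apply/implyP=> ef.
rewrite !ffunE; apply: contraTneq ef => /(congr1 enum_val).
rewrite !enum_rankK_in // => wef; apply/pred0Pn; exists (w e) => /=.
have /andP[_ ->] := xchooseP (hit e).
by rewrite wef; have /andP[_ ->] := xchooseP (hit f).
Qed.

Lemma mixed_cover_of_colorable (H : sgraph) k : colorable (compl (line_graph H)) k ->
  exists S F, [/\ @mixed_cover H S F, {in F, forall T : {set H}, #|T| <= 3}
                 & #|S| + #|F| <= k].
Proof.
case/existsP=> c /forallP propc.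
(* Colours are treated one at a time; each adds at most one vertex or one set. *)
suff /(_ (enum 'I_k))[S [F [cardF le cov]]] : forall s : seq 'I_k,
    exists (S : {set H}) (F : {set {set H}}),
    [/\ {in F, forall T : {set H}, #|T| <= 3}, #|S| + #|F| <= size s
       & forall e, c e \in s ->
           (exists2 v, v \in S & v \in val e) \/ (exists2 T, T \in F & val e \subset T)].
  exists S, F; split=> //; last by rewrite size_enum_ord in le.
  apply/mixed_coverP=> x y xy xS yS.
  have xyE : is_edge [set x; y].
    by apply/existsP; exists x; apply/existsP; exists y; rewrite xy eqxx.
  case: (cov (exist (@is_edge H) _ xyE)) => [|[v vS]|[T TF]]; first by rewrite mem_enum.
    by rewrite /= !inE => /orP[]/eqP ev; rewrite ev ?(negPf xS) ?(negPf yS) in vS.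
  by rewrite /= subUset !sub1set; exists T.
elim=> [|i s [S [F [cardF le cov]]]].
  by exists set0, set0; rewrite !cards0; split=> // T; rewrite inE.
pose C := [set val e | e : edge H & c e == i].
have pairC : {in C, forall e : {set H}, #|e| = 2}.
  move=> _ /imsetP[[e /= eE] _ ->] /=; case/existsP: eE => x /existsP[y /andP[xy /eqP->]].
  by rewrite cards2 (adj_neq xy).
have interC : {in C &, forall e f : {set H}, ~~ [disjoint e & f]}.
  move=> _ _ /imsetP[e + ->] /imsetP[f + ->]; rewrite !inE => /eqP ce /eqP cf.
  rewrite -compl_line_adjE; have /forallP/(_ f) := propc e.
  by rewrite ce cf eqxx implybF.
have inC e : c e = i -> val e \in C by move=> ce; apply: imset_f; rewrite inE ce.
have [C0|C0] := eqVneq C set0.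
  exists S, F; split=> // [|e]; first exact: leq_trans le (leqnSn _).
  rewrite inE => /orP[/eqP/inC|]; [by rewrite C0 inE | exact: cov].
have [[v vC]|[A A3 AC]] := intersecting_pairs pairC interC C0.
  exists (v |: S), F; split=> // [|e].
    rewrite /= -add1n (leq_trans _ (leq_add (leqnn 1) le)) // addnA leq_add2r.
    by rewrite cardsU1 leq_add2r leq_b1.
  rewrite inE => /orP[/eqP/inC/vC ve|/cov[[u uS ue]|]]; last by right.
    by left; exists v; rewrite ?setU11.
  by left; exists u; rewrite // setU1r.
exists S, (A |: F); split=> [T||e].
- by rewrite !inE => /orP[/eqP->|/cardF].
- rewrite /= -add1n (leq_trans _ (leq_add (leqnn 1) le)) // addnCA leq_add2l.
  by rewrite cardsU1 leq_add2r leq_b1.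
- rewrite inE => /orP[/eqP/inC/AC eA|/cov[|[T TF eT]]]; first 1 last.
  + by left.
  + by right; exists T; rewrite // setU1r.
  by right; exists A; rewrite ?setU11.
Qed.

Theorem theorem2 (H : sgraph) :
  ~~ complete H ->
  ~ has_induced coclaw H ->
  ~ has_induced butterfly H ->
  chi (compl (line_graph H)) = tau H.
Proof.
move=> ncomp noclaw nofly; apply/eqP; rewrite eqn_leq chi_le_tau /=.
rewrite {1}/chi; case: ex_minnP => k /mixed_cover_of_colorable[S [F [cov cardF le]]] _.
have [C covC leC] := vertex_cover_of_mixed ncomp noclaw nofly cov cardF.
rewrite /tau; case: arg_minnP => [|D _ minD]; first exact: vertex_coverT.
exact: leq_trans (minD C covC) (leq_trans leC le).
Qed.
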